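(* Let $G$ be a finite simple graph on $n$ vertices with at least one edge, with degree sequence $(d_1,d_2,\ldots,d_n)$ where $d_1\ge d_2\ge\cdots\ge d_n$. Let $G_t=G_t(E(G))$ be the graph obtained from $G$ by replacing every edge by a path of length $t$. Then for any fixed positive integer $k$, \[\lim_{t\to\infty}\lambda_k(G_t)=-\lim_{t\to\infty}\lambda_{|G_t|-k+1}(G_t)=\begin{cases}\dfrac{d_k}{\sqrt{d_k-1}} & \text{if } 1\le k\le n \text{ and } d_k\ge 3,\\[2mm] 2 & \text{otherwise.}\end{cases}\]
   Context: For a finite simple graph $F$ on $m$ vertices, $\lambda_1(F)\ge\cdots\ge\lambda_m(F)$ denote the eigenvalues of its adjacency matrix and $|F|$ its number of vertices. Replacing an edge $uv$ by a path of length $t$ means deleting $uv$ and adding a path with $t$ edges and $t-1$ new internal vertices joining $u$ and $v$. *)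

(* Defs.v *)
From HB Require Import structures.
From mathcomp Require Import all_boot all_order all_algebra.
From mathcomp Require Import all_classical all_reals all_analysis.
From mathcomp Require Import spectral.
From mathcomp Require complex.

Set Implicit Arguments.
Unset Strict Implicit.
Unset Printing Implicit Defensive.

Import Order.TTheory GRing.Theory Num.Theory.
Import numFieldNormedType.Exports.

Local Open Scope ring_scope.

Record sgraph := SGraph {
  vertex :> finType;
  adj : rel vertex;
  adj_sym : symmetric adj;
  adj_irrefl : irreflexive adj }.

Section Degrees.
Variable G : sgraph.

Definition degree (v : G) : nat := #|[set w | adj v w]|.

Definition degree_seq : seq nat := sort geq [seq degree v | v <- enum G].

(* Degrees are numbered from 1, as d_1 >= ... >= d_n. *)
Definition deg (k : nat) : nat := nth 0%N degree_seq k.-1.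

End Degrees.

Section Eigenvalues.
Variable R : realType.

Definition adjmx (G : sgraph) : 'M[R]_#|G| :=
  \matrix_(i, j) (adj (enum_val i) (enum_val j))%:R.

(* The eigenvalues with multiplicity, in nonincreasing order, of a matrix whose
   characteristic polynomial splits over R. Such a sequence is unique up to
   permutation, so that sorting makes the result independent of the choice made
   by xget; it exists for symmetric matrices, by char_poly_eigenvalues. *)
Definition eigenvalues n (A : 'M[R]_n) : seq R :=
  sort >=%R
    (xget [::] [set s : seq R | char_poly A = \prod_(x <- s) ('X - x%:P)]%classic).

(* Numbered from 1 as well: lambda G 1 >= ... >= lambda G #|G|. *)
Definition lambda (G : sgraph) (k : nat) : R :=
  nth 0 (eigenvalues (adjmx G)) k.-1.

End Eigenvalues.

Section Splitting.
Import complex.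

Lemma char_poly_similar (F : fieldType) n (P D : 'M[F]_n) :
  P \in unitmx -> char_poly (invmx P *m D *m P) = char_poly D.
Proof.
move=> uP; rewrite /char_poly /char_poly_mx !map_mxM.
have PK : map_mx polyC (invmx P) *m map_mx polyC P = 1%:M.
  by rewrite -map_mxM mulVmx// map_mx1.
have eX : 'X%:M = map_mx polyC (invmx P) *m 'X%:M *m map_mx polyC P.
  by rewrite scalar_mxC -mulmxA PK mulmx1.
by rewrite [in LHS]eX -mulmxBl -mulmxBr !det_mulmx mulrAC -det_mulmx PK det1 mul1r.
Qed.

Lemma char_poly_split (R : realType) n (A : 'M[R]_n) :
  A^T = A -> exists s : seq R, char_poly A = \prod_(x <- s) ('X - x%:P).
Proof.
move=> symA; pose B : 'M[complex R]_n := map_mx (real_complex R) A.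
have hB : B \is hermsymmx.
  apply/is_hermitianmxP; rewrite expr0 scale1r -map_trmx.
  apply/matrixP => i j; rewrite !mxE.
  by rewrite -[in LHS]symA mxE; exact/esym/conjc_real.
have /orthomx_spectralP eB := hermitian_normalmx hB.
have /mxOverP rB := hermitian_spectral_diag_real hB.
have uP := spectral_unit B.
set d := spectral_diag B in eB rB; set P := spectralmx B in eB uP.
have cB : char_poly B = \prod_(i < n) ('X - (d 0 i)%:P).
  transitivity (char_poly (diag_mx d)); last first.
    rewrite char_poly_trig ?diag_mx_is_trig//.
    by apply: eq_bigr => i _; rewrite mxE eqxx mulr1n.
  by rewrite eB; exact: char_poly_similar.
exists [seq Re (d 0 i) | i <- enum 'I_n].
apply: (map_poly_inj (real_complex R)); rewrite map_char_poly -/B cB rmorph_prod big_map big_enum /=.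
apply: eq_bigr => i _.
by rewrite rmorphB /= map_polyX map_polyC /= RRe_real.
Qed.

End Splitting.

Lemma char_poly_eigenvalues (R : realType) n (A : 'M[R]_n) :
  A^T = A -> char_poly A = \prod_(x <- eigenvalues A) ('X - x%:P).
Proof.
move=> /char_poly_split exs.
rewrite /eigenvalues (perm_big _ (permEl (perm_sort _ _))).
exact: (xgetPex [::] exs).
Qed.

Lemma adjmx_sym (R : realType) (G : sgraph) : (adjmx R G)^T = adjmx R G.
Proof. by apply/matrixP => i j; rewrite !mxE adj_sym. Qed.

Section Subdivision.
Variables (G : sgraph) (t : nat).

(* Each edge is represented once, oriented along the enumeration of G. *)
Definition edge : finType :=
  {p : G * G | adj p.1 p.2 && (enum_rank p.1 < enum_rank p.2)%N}.

Definition subdiv_vertex : finType := (G + edge * 'I_t.-1)%type.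

(* The vertex at position i <= t (0 < t) of the path that replaces uv: u at
   position 0, the t - 1 internal vertices at positions 1, ..., t - 1, and v at
   position t, which is where insub first returns None. *)
Definition path_vertex (p : edge) (i : nat) : subdiv_vertex :=
  if i is j.+1 then
    if insub j is Some o then inr (p, o) else inl (val p).2
  else inl (val p).1.

Definition subdiv_adj : rel subdiv_vertex := fun x y =>
  [exists p : edge, exists i : 'I_t,
    ((x == path_vertex p i) && (y == path_vertex p i.+1))
    || ((y == path_vertex p i) && (x == path_vertex p i.+1))].

Lemma subdiv_adj_sym : symmetric subdiv_adj.
Proof.
by move=> x y; apply: eq_existsb => p; apply: eq_existsb => i; rewrite orbC.
Qed.

Lemma path_vertex_neq p (i : 'I_t) : path_vertex p i != path_vertex p i.+1.
Proof.
case: i => -[|j] lt_j /=; case: insubP => //=.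
- move=> _; case: p => -[u v] /= /andP[_];
  by apply: contraTneq => -[->]; rewrite ltnn.
- move=> o _ eo; case: insubP => // o' _ eo'; apply/eqP => -[oo].
  by move: eo; rewrite oo eo' => /esym/n_Sn.
- by rewrite ltn_predRL lt_j.
Qed.

Lemma subdiv_adj_irrefl : irreflexive subdiv_adj.
Proof.
move=> x; apply/existsP => -[p /existsP[i]]; rewrite orbb.
by move=> /andP[/eqP-> /idPn]; rewrite path_vertex_neq.
Qed.

Definition subdivision : sgraph := SGraph subdiv_adj_sym subdiv_adj_irrefl.

End Subdivision.

(* Main.v *)
(* Put D = max(d_k, 2) and q = 1 / sqrt(D - 1), so that the limit is
   L = q + 1/q = D q, and let s = 1 or s = -1; both ends of the spectrum are
   treated together, as the largest eigenvalues of s A.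

   Upper bound: on the functions vanishing at the fewer than k vertices of degree
   > D, bound each term 2 s f(x) f(y) along a subdivided edge by
   w f(x)^2 + f(y)^2 / w, where w climbs along the edge from q to 1/q in steps of
   at most e. Inner vertices then receive at most q + 1/q + e, and a vertex of
   degree d <= D receives d q <= L.

   Lower bound: k test functions with pairwise disjoint and non-adjacent supports.
   If D >= 3, take at each vertex of degree >= D the truncation of
   (s q)^distance; if L = 2, take s^position on k long segments of a single
   subdivided edge. *)

Require Import Defs.
From mathcomp Require Import all_boot all_order all_algebra.
From mathcomp Require Import all_classical all_reals all_analysis.
From mathcomp Require Import spectral.
From mathcomp Require complex.
From mathcomp Require Import ring lra zify.
Import Order.TTheory GRing.Theory Num.Theory.
Import numFieldNormedType.Exports.
Local Open Scope classical_set_scope.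
Local Open Scope ring_scope.

Set Implicit Arguments.
Unset Strict Implicit.
Unset Printing Implicit Defensive.

(** * Counting eigenvalues of a real symmetric matrix by subspaces *)

Section SpectralCount.
Import complex.
Local Open Scope sesquilinear_scope.

(** The complexification of [A] is Hermitian, hence unitarily diagonalizable with real eigenvalues.
    Comparing the linear factors of the characteristic polynomial identifies them, with
    multiplicity, with [eigenvalues A]. *)
Lemma real_symmetric_spectral (R : realType) n (A : 'M[R]_n) : A^T = A ->
  exists (P : 'M[R[i]]_n) (d : 'I_n -> R),
    [/\ P \is unitarymx,
        map_mx (real_complex R) A =
          P^t* *m diag_mx (\row_i real_complex R (d i)) *m P
      & perm_eq (eigenvalues A) [seq d i | i <- enum 'I_n]].
Proof.
move=> symA; set B := map_mx (real_complex R) A.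
have hB : B \is hermsymmx.
  apply/is_hermitianmxP; rewrite expr0 scale1r -map_trmx.
  apply/matrixP => i j; rewrite !mxE -[in LHS]symA mxE.
  exact/esym/conjc_real.
have /orthomx_spectralP eB := hermitian_normalmx hB.
have /mxOverP rB := hermitian_spectral_diag_real hB.
have uP := spectral_unitarymx B.
exists (spectralmx B), (fun i => Re (spectral_diag B 0 i)).
have dE : \row_i real_complex R (Re (spectral_diag B 0 i)) = spectral_diag B.
  by apply/rowP => i; rewrite mxE RRe_real.
split=> //; first by rewrite dE -invmx_unitary.
apply: (perm_map_inj (@complexI R)); apply: prod_XsubC_eq.
rewrite big_map -map_prod_XsubC -char_poly_eigenvalues// map_char_poly -/B.
rewrite [in LHS]eB char_poly_similar ?spectral_unit// char_poly_trig ?diag_mx_is_trig//.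
rewrite [RHS]big_map [RHS]big_map big_enum /=; apply: eq_bigr => i _.
by rewrite mxE eqxx mulr1n RRe_real.
Qed.

(** The two cross terms cancel because [M] is symmetric. Positivity of a form on a real subspace
    thus carries over to its complexification. *)
Lemma quadratic_form_complexify (R : realType) n (M : 'M[R]_n) (a b : 'rV[R]_n) :
  M^T = M ->
  let z := map_mx (real_complex R) a + 'i%C *: map_mx (real_complex R) b in
  z *m map_mx (real_complex R) M *m z^t* =
    map_mx (real_complex R) (a *m M *m a^T + b *m M *m b^T).
Proof.
move=> symM z.
have zE : z^t* = map_mx (real_complex R) a^T - 'i%C *: map_mx (real_complex R) b^T.
  apply/matrixP => i j; rewrite !mxE rmorphD rmorphM /=.
  by rewrite -!complexr0 /=; simpc.
have bMa : b *m M *m a^T = a *m M *m b^T.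
  have <- : (b *m M *m a^T)^T = b *m M *m a^T.
    by rewrite [b *m M *m a^T]mx11_scalar tr_scalar_mx.
  by rewrite !trmx_mul trmxK symM mulmxA.
rewrite zE !mulmxDl mulmxDr mulmxN -!scalemxAl -!scalemxAr mulmxDr mulmxN.
rewrite -!scalemxAr -!map_mxM bMa map_mxD scalerBr scalerA.
have -> : 'i%C * 'i%C = -1 :> R[i] by rewrite -expr2 sqr_i.
rewrite scaleN1r opprK.
by rewrite addrA subrK.
Qed.

(* Otherwise the eigenvectors whose eigenvalues satisfy [c <= s * x] span less
   than [m] dimensions, and some nonzero vector of the complexified row space of
   [V] is orthogonal to all of them; there the form of [s *: A - c%:M] is negative. *)
Lemma leq_count_eigenvalues (R : realType) m n (A : 'M[R]_n) (V : 'M[R]_(m, n))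
    (s c : R) :
  A^T = A -> row_free V ->
  (forall u : 'rV_m, 0 <= (u *m V *m (s *: A - c%:M) *m (u *m V)^T) 0 0) ->
  (m <= count (fun x => (c <= s * x)%R) (eigenvalues A))%N.
Proof.
move=> symA freeV posV.
have [P [d [uP AE /permP ->]]] := real_symmetric_spectral symA.
rewrite count_map; set T := [set i | c <= s * d i]%SET.
have -> : count (preim d (fun x => c <= s * x)) (enum 'I_n) = #|T|.
  by rewrite -sum1_count -sum1_card big_enum_cond; apply: eq_bigl => i; rewrite !inE.
rewrite leqNgt; apply/negP => ltTm.
pose VC := map_mx (real_complex R) V.
pose K : 'M[R[i]]_(m, #|T|) := \matrix_(i, j) (VC *m P^t*) i (enum_val j).
have /rowV0Pn[u /sub_kermxP uK u0] : kermx K != 0.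
  rewrite -mxrank_eq0 mxrank_ker subn_eq0 -ltnNge.
  exact: leq_ltn_trans (rank_leq_col _) ltTm.
pose a := map_mx (@Re R) u; pose b := map_mx (@Im R) u.
pose z := u *m VC; pose y := z *m P^t*.
have zE : z = map_mx (real_complex R) (a *m V) + 'i%C *: map_mx (real_complex R) (b *m V).
  rewrite !map_mxM scalemxAl -mulmxDl; congr (_ *m _).
  by apply/matrixP => i j; rewrite !mxE -complexE.
pose M := s *: A - c%:M.
have symM : M^T = M by rewrite /M linearB /= linearZ /= symA tr_scalar_mx.
(* In the eigenvector coordinates [y] of [z] the form is a weighted sum of squared moduli. *)
have formE : (z *m map_mx (real_complex R) M *m z^t*) 0 0 =
    real_complex R (\sum_i (s * d i - c) * (Re (y 0 i) ^+ 2 + Im (y 0 i) ^+ 2)).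
  have PP : P^t* *m P = 1%:M by rewrite -invmx_unitary// mulVmx// unitarymx_unit.
  have -> : map_mx (real_complex R) M =
      P^t* *m diag_mx (\row_i real_complex R (s * d i - c)) *m P.
    rewrite /M map_mxB map_mxZ AE map_scalar_mx /=.
    have -> : diag_mx (\row_i real_complex R (s * d i - c)) =
      real_complex R s *: diag_mx (\row_i real_complex R (d i)) - (real_complex R c)%:M.
      apply/matrixP => i j; rewrite !mxE rmorphB rmorphM mulrnBl.
      by rewrite -mulrnAr.
    rewrite mulmxBr mulmxBl -scalemxAr -scalemxAl; congr (_ - _).
    by rewrite mul_mx_scalar -scalemxAl PP scalemx1.
  have yE : P *m z^t* = y^t* by rewrite /y [(z *m _)^T]trmx_mul [in RHS]map_mxM trmxCK.
  rewrite !mulmxA -(mulmxA _ P) yE -/y; clearbody y.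
  rewrite mxE rmorph_sum /=.
  apply: eq_bigr => i _; rewrite mul_mx_diag !mxE rmorphM mulrAC mulrC.
  congr (_ * _); case: (y 0 i) => p q /=.
  by apply/eqP; rewrite eq_complex /=; apply/andP; split; apply/eqP; ring.
have : 0 <= \sum_i (s * d i - c) * (Re (y 0 i) ^+ 2 + Im (y 0 i) ^+ 2).
  suff : 0 <= real_complex R (\sum_i (s * d i - c) * (Re (y 0 i) ^+ 2 + Im (y 0 i) ^+ 2)).
    by rewrite ler0c.
  rewrite -formE zE quadratic_form_complexify// mxE ler0c mxE.
  exact: addr_ge0.
apply/negP; rewrite -ltNge.
have yT i : i \in T -> y 0 i = 0.
  move=> iT; have /rowP/(_ (enum_rank_in iT i)) := uK.
  rewrite /y /z -mulmxA !mxE => e; rewrite -[RHS]e.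
  by apply: eq_bigr => j _; rewrite [K _ _]mxE enum_rankK_in.
(* [u] is nonzero, and right multiplication by [VC] and by the unitary factor is injective. *)
have [i yi] : exists i, y 0 i != 0.
  apply/existsP; rewrite -negb_forall; apply: contra u0 => /forallP y0.
  have : u *m (VC *m P^t*) = 0.
    by apply/rowP => i; rewrite mulmxA [RHS]mxE; exact/eqP/y0.
  move/eqP; rewrite mulmx_free_eq0//.
  rewrite /row_free mxrankMfree ?map_mx_is_free//.
    by rewrite mxrank_map.
  by rewrite row_free_unit -invmx_unitary// unitmx_inv unitarymx_unit.
have neg j : j \notin T -> s * d j - c < 0 by rewrite inE -ltNge subr_lt0.
have yn j : y 0 j != 0 -> j \notin T by apply: contraNN => /yT/eqP.
rewrite (bigD1 i)//= -[ltRHS]addr0 ltr_leD//.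
  rewrite nmulr_rlt0 ?neg ?yn// lt0r addr_ge0 ?sqr_ge0// andbT.
  apply: contra yi; rewrite paddr_eq0 ?sqr_ge0// !sqrf_eq0.
  by case: (y 0 i) => p q /= /andP[/eqP-> /eqP->].
apply: sumr_le0 => j _; have [->|/yn/neg/ltW] := eqVneq (y 0 j) 0.
  by rewrite /= expr0n addr0 mulr0.
by move=> le0; rewrite mulr_le0_ge0// addr_ge0 ?sqr_ge0.
Qed.

End SpectralCount.

(** * Counting adjacency eigenvalues with test functions *)

Lemma bilinear_sum (R : realType) (T I : finType) (K : T -> T -> R) (a : I -> R)
    (f : I -> T -> R) :
  \sum_x \sum_y K x y * (\sum_i a i * f i x) * (\sum_i a i * f i y) =
  \sum_i \sum_j a i * a j * \sum_x \sum_y K x y * f i x * f j y.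
Proof.
under eq_bigr do under eq_bigr do rewrite -mulrA big_distrlr mulr_sumr.
under eq_bigr do under eq_bigr do under eq_bigr do rewrite mulr_sumr.
under [RHS]eq_bigr do under eq_bigr do rewrite mulr_sumr.
under [RHS]eq_bigr do under eq_bigr do under eq_bigr do rewrite mulr_sumr.
under eq_bigr do rewrite exchange_big.
rewrite exchange_big; apply: eq_bigr => i _ /=.
under eq_bigr do rewrite exchange_big.
rewrite exchange_big; apply: eq_bigr => j _ /=.
by apply: eq_bigr => x _; apply: eq_bigr => y _; ring.
Qed.

Lemma sum_diag (R : realType) (T : finType) (f g : T -> R) :
  \sum_x \sum_y (x == y)%:R * f x * g y = \sum_x f x * g x.
Proof.
apply: eq_bigr => x _; rewrite (bigD1 x)//= eqxx mul1r big1 ?addr0// => y.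
by rewrite eq_sym => /negPf ->; rewrite !mul0r.
Qed.

Section EigenvalueCounts.
Variables (R : realType) (H : sgraph).

Definition adj_form (f g : H -> R) : R := \sum_x \sum_y (adj x y)%:R * f x * g y.

Lemma adj_formE (s c : R) (w : 'rV[R]_#|H|) (f : H -> R) :
  (forall j, w 0 j = f (enum_val j)) ->
  (w *m (s *: adjmx R H - c%:M) *m w^T) 0 0 =
  s * adj_form f f - c * \sum_x f x * f x.
Proof.
move=> wE.
have big_val (F : H -> R) : \sum_x F x = \sum_(j < #|H|) F (enum_val j).
  by rewrite -big_enum_val; apply: eq_bigl.
rewrite mulmxBr mulmxBl -scalemxAr -scalemxAl mul_mx_scalar -scalemxAl !mxE.
congr (_ * _ - _ * _); last first.
  by rewrite big_val; apply: eq_bigr => j _; rewrite mxE !wE.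
rewrite /adj_form exchange_big big_val; apply: eq_bigr => j _.
rewrite big_val !mxE mulr_suml; apply: eq_bigr => i _.
by rewrite !mxE !wE [X in X * _]mulrC.
Qed.

Lemma size_eigenvalues : size (eigenvalues (adjmx R H)) = #|H|.
Proof.
have := congr1 (fun p : {poly R} => size p) (char_poly_eigenvalues (adjmx_sym R H)).
by rewrite size_char_poly size_prod_XsubC => -[].
Qed.

(** Both Gram matrices of the family, for the inner product and for the adjacency form, are
    diagonal. So a bound on each Rayleigh quotient extends to the whole span, and positive norms
    make the family linearly independent. *)
Lemma count_eigenvalues_family (I : finType) (f : I -> H -> R) (s c : R) :
  (forall i j, i != j -> \sum_x f i x * f j x = 0) ->
  (forall i j, i != j -> adj_form (f i) (f j) = 0) ->
  (forall i, 0 < \sum_x f i x * f i x) ->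
  (forall i, c * (\sum_x f i x * f i x) <= s * adj_form (f i) (f i)) ->
  (#|I| <= count (fun x => (c <= s * x)%R) (eigenvalues (adjmx R H)))%N.
Proof.
move=> orth adj0 pos form.
pose V : 'M[R]_(#|I|, #|H|) := \matrix_(i, j) f (enum_val i) (enum_val j).
have VE (u : 'rV_#|I|) j :
    (u *m V) 0 j = \sum_i u 0 (enum_rank i) * f i (enum_val j).
  rewrite mxE (reindex enum_rank) /=; last exact/onW_bij/enum_rank_bij.
  by apply: eq_bigr => i _; rewrite mxE enum_rankK.
have diag (a : I -> R) (B : I -> I -> R) : (forall i j, i != j -> B i j = 0) ->
    \sum_i \sum_j a i * a j * B i j = \sum_i a i ^+ 2 * B i i.
  move=> B0; apply: eq_bigr => i _; rewrite (bigD1 i)//= big1 ?addr0// => j.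
  by rewrite eq_sym => /B0 ->; rewrite mulr0.
have normE (a : I -> R) : \sum_x (\sum_i a i * f i x) * (\sum_i a i * f i x) =
    \sum_i a i ^+ 2 * \sum_x f i x * f i x.
  rewrite -sum_diag bilinear_sum diag => [|i j ij]; last by rewrite sum_diag orth.
  by apply: eq_bigr => i _; rewrite sum_diag.
apply: (leq_count_eigenvalues (V := V)); first exact: adjmx_sym.
  rewrite -kermx_eq0; apply/rowV0P => u /sub_kermxP uV.
  have F0 x : \sum_i u 0 (enum_rank i) * f i x = 0.
    by rewrite -[x]enum_rankK -VE uV mxE.
  have /eqP := normE (fun i => u 0 (enum_rank i)).
  rewrite big1 => [|x _]; last by rewrite F0 mul0r.
  rewrite eq_sym psumr_eq0 => [/allP a0|i _]; last first.
    by rewrite mulr_ge0 ?sqr_ge0// ltW.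
  apply/rowP => i; have := a0 (enum_val i) (mem_index_enum _).
  by rewrite enum_valK mulf_eq0 sqrf_eq0 (gt_eqF (pos _)) orbF mxE => /eqP.
move=> u.
rewrite (@adj_formE s c _ (fun x => \sum_i u 0 (enum_rank i) * f i x))//.
rewrite normE /adj_form bilinear_sum diag; last exact: adj0.
rewrite !mulr_sumr -sumrB; apply: sumr_ge0 => i _.
by rewrite mulrCA [c * _]mulrCA -mulrBr mulr_ge0 ?sqr_ge0// subr_ge0.
Qed.

(** The indicators of the vertices outside [S] span a subspace of codimension [#|S|]; the subspace
    count applies there with [- s] and [- c]. *)
Lemma count_eigenvalues_vanishing (S : {set H}) (s c : R) :
  (forall f : H -> R, (forall x, x \in S -> f x = 0) ->
     s * adj_form f f <= c * \sum_x f x * f x) ->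
  (#|H| - #|S| <= count (fun x => (s * x <= c)%R) (eigenvalues (adjmx R H)))%N.
Proof.
move=> form.
have -> : (fun x => s * x <= c) = (fun x => - c <= - s * x).
  by apply/funext => x; rewrite mulNr lerN2.
pose V : 'M[R]_(#|~: S|, #|H|) := \matrix_(i, j) (enum_val i == enum_val j)%:R.
have -> : (#|H| - #|S|)%N = #|~: S| by rewrite [RHS]cardsCs finset.setCK.
apply: (leq_count_eigenvalues (V := V)).
- exact: adjmx_sym.
- rewrite -kermx_eq0; apply/rowV0P => u /sub_kermxP uV.
  apply/rowP => i; have /rowP/(_ (enum_rank (enum_val i))) := uV.
  rewrite !mxE (bigD1 i)//= !mxE enum_rankK eqxx mulr1 big1 ?addr0// => j ji.
  by rewrite !mxE enum_rankK (inj_eq enum_val_inj) (negPf ji) mulr0.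
move=> u; pose f x := \sum_i u 0 i * (enum_val i == x)%:R.
rewrite (@adj_formE (- s) (- c) _ f); last first.
  by move=> j; rewrite mxE; apply: eq_bigr => i _; rewrite mxE.
rewrite !mulNr opprK addrC subr_ge0; apply: form => x xS.
apply: big1 => i _; case: eqP => [ix|]; rewrite ?mulr0//.
by have := enum_valP i; rewrite ix !inE xS.
Qed.

End EigenvalueCounts.

(** * From counts to entries of a nonincreasing list *)

Section SortedCounts.
Variables (R : realType).

Lemma nth_sorted_ge (E : seq R) (c : R) k : sorted >=%R E ->
  (k < count (>= c) E)%N -> c <= nth 0 E k.
Proof.
elim: E k => [|x E IH] k //= srt.
have sE : sorted >=%R E by apply: path_sorted srt.
have xE y : y \in E -> y <= x.
  move=> yE; have := order_path_min (rev_trans le_trans) srt.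
  by move=> /allP/(_ _ yE).
case: k => [|k] /=; last by move=> h; apply: IH => //; case: (c <= x) h => /=; lia.
case: leP => // ltxc.
suff -> : count (>= c) E = 0%N by [].
apply/eqP; rewrite -leqn0 leqNgt -has_count; apply/hasPn => y /xE yx.
by rewrite -ltNge (le_lt_trans yx).
Qed.

Lemma nth_sorted_le (E : seq R) (c : R) k : sorted >=%R E -> (k < size E)%N ->
  (size E - k <= count (<= c) E)%N -> nth 0 E k <= c.
Proof.
move=> srt kE cnt; rewrite leNgt; apply/negP => ltc.
(* If the entry at index [k] exceeds [c], so do the [k] entries before it, which leaves too few
   entries at most [c]. *)
have : (k < count (> c) E)%N.
  elim: E k srt kE ltc {cnt} => [|x E IH] //= [|k] /= srt kE ltc.
    by rewrite ltc.
  rewrite (_ : c < x) ?add1n ?ltnS; first by apply: IH => //; apply: path_sorted srt.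
  apply: lt_le_trans ltc _.
  have := order_path_min (rev_trans le_trans) srt => /allP; apply.
  by rewrite mem_nth.
have := count_predC (<= c) E.
rewrite (@eq_count _ (predC _) (> c)); last by move=> x /=; rewrite ltNge.
by move=> e h; move: cnt; rewrite leq_subLR -e addnC leq_add2r leqNgt h.
Qed.

End SortedCounts.

(** * The paths of a subdivision and sums over them *)

Section PathVertex.
Variables (G : sgraph) (t : nat).
Implicit Types (p : edge G) (i j : nat).
Local Notation pv := (@path_vertex G t).

Lemma path_vertex_last p : (0 < t)%N -> pv p t = inl (val p).2.
Proof.
by case: t => // t' _ /=; case: insubP => //= o; rewrite ltnn.
Qed.

Lemma path_vertex_inner p (o : 'I_t.-1) : pv p o.+1 = inr (p, o).
Proof. by rewrite /= valK. Qed.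

Lemma path_vertex_inj p p' i i' : (0 < i < t)%N ->
  pv p i = pv p' i' -> p = p' /\ i = i'.
Proof.
case: i => // i /andP[_ it].
have it' : (i < t.-1)%N by lia.
rewrite (path_vertex_inner p (Ordinal it')).
case: i' => [|i'] //=; case: insubP => // o _ <- [<- <-].
by split.
Qed.

Lemma path_vertex_ends p : (0 < t)%N -> pv p 0 <> pv p t.
Proof.
move=> t0; rewrite path_vertex_last//= => -[e].
by case: p e => -[u v] /= /andP[_ uv] e; rewrite e ltnn in uv.
Qed.

(** Step [i] of the path of [p], walked forwards or backwards according to [b]. *)
Definition arc (z : edge G * 'I_t * bool) : subdivision G t * subdivision G t :=
  let: (p, i, b) := z in
  if b then (pv p i, pv p i.+1) else (pv p i.+1, pv p i).

(** For t > 1 every step has an inner endpoint, which determines the path and its position on it.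
    Two arcs of opposite direction could agree only if the two ends of a path coincided. *)
Lemma arc_inj : (1 < t)%N -> injective arc.
Proof.
move=> t1.
have same p p' (i i' : 'I_t) : pv p i = pv p' i' -> pv p i.+1 = pv p' i'.+1 ->
    (p, i) = (p', i').
  move=> e e'; have [i0|i0] := posnP i.
    have [|-> [/ord_inj ->]//] := path_vertex_inj _ e'; lia.
  have [|-> /ord_inj ->//] := path_vertex_inj _ e; by rewrite i0 ltn_ord.
have opp p p' (i i' : 'I_t) : pv p i = pv p' i'.+1 -> pv p i.+1 = pv p' i' -> False.
  move=> e e'; have it := ltn_ord i; have it' := ltn_ord i'.
  have t0 : (0 < t)%N by lia.
  have [i0|i0] := posnP i.
    have [|ep ei] := path_vertex_inj _ e'; first lia.
    have i't : i'.+1 = t.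
      apply: contrapT => ne; have [|_] := path_vertex_inj _ (esym e); lia.
    by move: e; rewrite i't i0 -ep => /path_vertex_ends; apply.
  have [|ep ei] := path_vertex_inj _ e; first lia.
  have it1 : i.+1 = t.
    apply: contrapT => ne; have [|_] := path_vertex_inj _ e'; lia.
  have i'0 : i' = 0%N :> nat.
    apply: contrapT => ne; have [|_] := path_vertex_inj _ (esym e'); lia.
  by move: e'; rewrite it1 i'0 -ep => /esym/path_vertex_ends; apply.
move=> [[p i] []] [[p' i'] []] /= [e e'].
- by rewrite (same _ _ _ _ e e').
- by case: (opp _ _ _ _ e e').
- by case: (opp _ _ _ _ e' e).
- by rewrite (same _ _ _ _ e' e).
Qed.

Variable R : realType.

Lemma sum_adj_subdivision (h : subdivision G t -> subdivision G t -> R) :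
  (1 < t)%N ->
  \sum_x \sum_y (adj x y)%:R * h x y =
  \sum_(p : edge G) \sum_(i < t) (h (pv p i) (pv p i.+1) + h (pv p i.+1) (pv p i)).
Proof.
move=> t1.
have -> : \sum_x \sum_y (adj x y)%:R * h x y =
    \sum_(q in arc @: [set: edge G * 'I_t * bool]%SET) h q.1 q.2.
  rewrite pair_bigA [RHS]big_mkcond; apply: eq_bigr => -[x y] _ /=.
  have -> : (x, y) \in arc @: [set: edge G * 'I_t * bool]%SET = adj x y.
    apply/imsetP/existsP.
      case=> [[[p i] b] _ /= e]; exists p; apply/existsP; exists i.
      by case: b e => -[-> ->]; rewrite !eqxx ?orbT.
    case=> p /existsP[i /orP[]/andP[/eqP-> /eqP->]].
    - by exists (p, i, true).
    - by exists (p, i, false).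
  by rewrite /=; case: (subdiv_adj x y); rewrite ?mul1r ?mul0r.
rewrite big_imset /=; last by move=> ? ? _ _; exact: arc_inj.
rewrite pair_bigA (eq_bigl xpredT) => [|?]; last by rewrite inE.
transitivity (\sum_q \sum_b h (arc (q, b)).1 (arc (q, b)).2).
  by rewrite pair_bigA; apply: eq_bigr => -[].
by apply: eq_bigr => -[p i] _; rewrite big_bool.
Qed.

Lemma sum_subdivision (F : subdivision G t -> R) :
  \sum_x F x = \sum_(v : G) F (inl v) +
               \sum_(p : edge G) \sum_(1 <= i < t) F (pv p i).
Proof.
rewrite big_sumType; congr (_ + _).
transitivity (\sum_(p : edge G) \sum_(o < t.-1) F (inr (p, o))).
  by rewrite pair_bigA; apply: eq_bigr => -[].
apply: eq_bigr => p _ /=.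
rewrite big_add1 big_mkord; apply: eq_bigr => o _.
by rewrite path_vertex_inner.
Qed.

(** Handshake counting: the neighbours of v that come after it in the enumeration give the edges
    with first end v, those that come before it the edges with second end v. *)
Lemma sum_edge_ends (F : G -> R) :
  \sum_(p : edge G) (F (val p).1 + F (val p).2) = \sum_v (degree v)%:R * F v.
Proof.
have sum_edge (K : G -> G -> R) : \sum_(p : edge G) K (val p).1 (val p).2 =
    \sum_v \sum_(w | adj v w && (enum_rank v < enum_rank w)%N) K v w.
  rewrite pair_big_dep /=; apply: esym.
  exact: (@big_sub _ _ _ (G * G)%type
    (fun q => adj q.1 q.2 && (enum_rank q.1 < enum_rank q.2)%N)
    (fun q => K q.1 q.2)).
rewrite big_split /= (sum_edge (fun v w => F v)) (sum_edge (fun v w => F w)).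
rewrite [X in _ + X](exchange_big_dep xpredT)//= -big_split /=.
apply: eq_bigr => v _;
rewrite /degree -[#|[set w | adj v w]%SET|]sum1_card natr_sum mulr_suml.
rewrite [RHS](bigID (fun w => enum_rank v < enum_rank w)%N) /=.
congr (_ + _); apply: eq_big => [w|w _]; rewrite ?inE ?mul1r//.
rewrite adj_sym -leqNgt ltn_neqAle; case: (boolP (adj v w)) => //= vw.
by case: eqVneq => // /ord_inj/enum_rank_inj wv; rewrite wv adj_irrefl in vw.
Qed.

End PathVertex.

(** * Upper bound for the adjacency form of a subdivision *)

Section UpperBound.
Variable R : realType.

(** The convex function w + 1/w takes the same value at both ends of the interval from q to 1/q. *)
Lemma addr_inv_le (q w : R) : 0 < q -> q <= w -> w <= q^-1 -> w + w^-1 <= q + q^-1.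
Proof.
move=> q0 qw wq; have w0 : 0 < w by exact: lt_le_trans qw.
rewrite -subr_ge0.
have -> : q + q^-1 - (w + w^-1) = (w - q) * (q^-1 - w) / w.
  by field; rewrite !gt_eqF.
by rewrite divr_ge0 ?mulr_ge0 ?subr_ge0// ltW.
Qed.

(* AM-GM with weights climbing from [q] to [q^-1] in steps of at most [e]. *)
Lemma path_form_le (g : nat -> R) (t : nat) (s q e : R) :
  s ^+ 2 = 1 -> 0 < q <= 1 -> 0 <= e -> (0 < t)%N -> q^-1 <= q + t.-1%:R * e ->
  \sum_(i < t) 2 * s * g i * g i.+1 <=
  q * (g 0%N ^+ 2 + g t ^+ 2) + (q + q^-1 + e) * \sum_(1 <= i < t) g i ^+ 2.
Proof.
move=> s1 /andP[q0 q1] e0; case: t => // t _ /= tq.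
have qV : q <= q^-1 by rewrite (le_trans q1)// invf_ge1.
(* By [tq] the cap [q^-1] is reached on the last step, so each end of the path receives exactly q:
   [w 0] at the first, the inverse of the last weight at the other. *)
pose w i : R := Num.min (q + i%:R * e) q^-1.
have wq i : q <= w i by rewrite le_min qV andbT lerDl mulr_ge0.
have w0 i : 0 < w i by exact: lt_le_trans (wq i).
have amgm i : 2 * s * g i * g i.+1 <= w i * g i ^+ 2 + (w i)^-1 * g i.+1 ^+ 2.
  rewrite -subr_ge0.
  have -> : w i * g i ^+ 2 + (w i)^-1 * g i.+1 ^+ 2 - 2 * s * g i * g i.+1 =
      (w i)^-1 * (w i * g i - s * g i.+1) ^+ 2 + (w i)^-1 * (1 - s ^+ 2) * g i.+1 ^+ 2.
    by field; rewrite gt_eqF.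
  by rewrite s1 subrr mulr0 mul0r addr0 mulr_ge0 ?sqr_ge0// invr_ge0 ltW.
apply: (le_trans (ler_sum _ (fun i : 'I_t.+1 => fun _ => amgm i))).
rewrite big_split /= big_ord_recl [X in _ + X]big_ord_recr /= big_add1 big_mkord /=.
have -> : w 0%N = q by rewrite /w mul0r addr0 min_l.
have -> : w t = q^-1 by rewrite /w min_r.
rewrite invrK mulr_sumr.
set X := \sum_(i < t) _; set Y := \sum_(i < t) _; set Z := \sum_(i < t) _.
(* An inner vertex receives the inverse of the weight before it plus the weight after it, which is
   at most [w i + (w i)^-1 + e]. *)
suff : X + Y <= Z by rewrite mulrDr; lra.
rewrite -big_split /=; apply: ler_sum => i _; rewrite -mulrDl.
apply: ler_wpM2r; first exact: sqr_ge0.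
have : w i.+1 <= w i + e.
  rewrite /w addr_minl -natr1 mulrDl mul1r addrA le_min ge_min lexx /=.
  by rewrite ge_min lerDl e0 orbT.
have : w i + (w i)^-1 <= q + q^-1.
  by apply: addr_inv_le => //; rewrite ge_min lexx orbT.
by rewrite /bump /=; lra.
Qed.

Variables (G : sgraph) (t : nat).

Lemma adj_form_subdivision (f g : subdivision G t -> R) : (1 < t)%N ->
  adj_form f g = \sum_(p : edge G) \sum_(i < t)
    (f (path_vertex t p i) * g (path_vertex t p i.+1) +
     f (path_vertex t p i.+1) * g (path_vertex t p i)).
Proof.
move=> t1; rewrite /adj_form.
under eq_bigr do under eq_bigr do rewrite -mulrA.
exact: sum_adj_subdivision.
Qed.

Lemma adj_form_subdivision_le (f : subdivision G t -> R) (D : nat) (s q e : R) :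
  (1 < t)%N -> s ^+ 2 = 1 -> 0 < q <= 1 -> 0 <= e -> q^-1 <= q + t.-1%:R * e ->
  D%:R * q = q + q^-1 ->
  (forall v : G, (D < degree v)%N -> f (inl v) = 0) ->
  s * adj_form f f <= (q + q^-1 + e) * \sum_x f x * f x.
Proof.
move=> t1 s1 q01 e0 tq Dq f0; have t0 := ltnW t1.
rewrite adj_form_subdivision// sum_subdivision mulr_sumr.
pose g p i := f (path_vertex t p i).
apply: (@le_trans _ _ (\sum_(p : edge G) (q * (g p 0%N ^+ 2 + g p t ^+ 2) +
    (q + q^-1 + e) * \sum_(1 <= i < t) g p i ^+ 2))).
  apply: ler_sum => p _; apply: (le_trans _ (path_form_le _ s1 q01 e0 t0 tq)).
  rewrite mulr_sumr; apply: ler_sum => i _.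
  by rewrite [leLHS](_ : _ = 2 * s * g p i * g p i.+1)// /g; ring.
rewrite big_split /= -!mulr_sumr mulrDr; apply: lerD => //.
have -> : \sum_(p : edge G) (g p 0%N ^+ 2 + g p t ^+ 2) =
    \sum_(p : edge G) (f (inl (val p).1) ^+ 2 + f (inl (val p).2) ^+ 2).
  by apply: eq_bigr => p _; rewrite /g path_vertex_last.
rewrite (sum_edge_ends (fun v => f (inl v) ^+ 2)) !mulr_sumr; apply: ler_sum => v _.
rewrite -expr2 mulrA; have [dD|/f0->] := leqP (degree v) D; last by rewrite expr0n !mulr0.
apply: ler_wpM2r; first exact: sqr_ge0.
apply: (@le_trans _ _ (q + q^-1)); last by rewrite lerDl.
by rewrite -Dq mulrC; case/andP: q01 => q0 _; rewrite ler_pM2r// ler_nat.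
Qed.

End UpperBound.

(** * Geometrically decaying test functions around vertices *)

Lemma sum_ord_truncate (R : realType) (F : nat -> R) (m n : nat) : (m <= n)%N ->
  (forall i, (m <= i)%N -> F i = 0) -> \sum_(i < n) F i = \sum_(i < m) F i.
Proof.
move=> mn F0; rewrite -!(big_mkord xpredT) (big_cat_nat (n := m))//=.
rewrite [X in _ + X]big_nat [X in _ + X]big1 ?addr0// => i /andP[mi _].
exact: F0.
Qed.

Section Stars.
Variables (R : realType) (G : sgraph) (t m : nat) (r : R).
Hypothesis mt : (m.*2.+1 < t)%N.

Definition trunc_geom (i : nat) : R := if (i <= m)%N then r ^+ i else 0.

(** Each inner vertex is measured from both ends of its path, since v may be either one. [mt] keeps
    the pieces around the two ends disjoint and non-adjacent. *)
Definition star (v : G) (x : subdivision G t) : R :=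
  match x with
  | inl u => (u == v)%:R
  | inr (p, o) => ((val p).1 == v)%:R * trunc_geom o.+1 +
                  ((val p).2 == v)%:R * trunc_geom (t - o.+1)
  end.

Lemma trunc_geom_disjoint i j : (m.*2 < i + j)%N -> trunc_geom i * trunc_geom j = 0.
Proof.
move=> ij; rewrite /trunc_geom; case: leqP => im; rewrite ?mul0r//.
by case: leqP => jm; rewrite ?mulr0//; exfalso; lia.
Qed.

(** The formula for inner vertices persists at both ends of the path, because the opposite end lies
    at distance t > m, beyond the truncation. *)
Lemma starE v p i : (i <= t)%N ->
  star v (path_vertex t p i) = ((val p).1 == v)%:R * trunc_geom i +
                               ((val p).2 == v)%:R * trunc_geom (t - i).
Proof.
case: i => [_|i it].
  by rewrite /= /trunc_geom subn0 leq0n expr0 mulr1 ifF ?mulr0 ?addr0//; lia.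
have [->|it'] := eqVneq i.+1 t.
  rewrite path_vertex_last /=; last lia.
  by rewrite /trunc_geom subnn leq0n expr0 mulr1 ifF ?mulr0 ?add0r//; lia.
have it1 : (i < t.-1)%N by lia.
by rewrite (path_vertex_inner p (Ordinal it1)).
Qed.

Lemma sum_ends_pair (v v' : G) :
  \sum_(p : edge G) (((val p).1 == v)%:R * ((val p).1 == v')%:R +
                     ((val p).2 == v)%:R * ((val p).2 == v')%:R) =
  (v == v')%:R * (degree v)%:R :> R.
Proof.
rewrite (sum_edge_ends (fun u => (u == v)%:R * (u == v')%:R)) (bigD1 v)//= eqxx.
rewrite big1 => [|u /negPf ->]; last by rewrite mul0r mulr0.
by rewrite mul1r addr0 mulrC.
Qed.

Lemma sum_star (v v' : G) : \sum_x star v x * star v' x =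
  (v == v')%:R * (1 + (degree v)%:R * \sum_(i < m) r ^+ i.+1 ^+ 2).
Proof.
rewrite sum_subdivision /= (bigD1 v)//= eqxx mul1r big1 => [|u /negPf ->];
  last by rewrite mul0r.
rewrite addr0 mulrDr mulr1 mulrA -sum_ends_pair mulr_suml; congr (_ + _).
apply: eq_bigr => p _.
set a := (_ == v)%:R; set a' := (_ == v')%:R.
set b := ((val p).2 == v)%:R; set b' := ((val p).2 == v')%:R.
have sq : \sum_(1 <= i < t) trunc_geom i ^+ 2 = \sum_(i < m) r ^+ i.+1 ^+ 2.
  rewrite big_add1 big_mkord.
  rewrite (@sum_ord_truncate _ (fun i => trunc_geom i.+1 ^+ 2) m) => [||i im].
  - by apply: eq_bigr => i _; rewrite /trunc_geom ltn_ord.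
  - by lia.
  - by rewrite /trunc_geom ltnNge im expr0n.
have sq' : \sum_(1 <= i < t) trunc_geom (t - i) ^+ 2 = \sum_(i < m) r ^+ i.+1 ^+ 2.
  rewrite -sq big_nat_rev; apply: eq_big_nat => i /andP[i0 it] /=.
  by congr (trunc_geom _ ^+ 2); lia.
transitivity (\sum_(1 <= i < t) (a * a' * trunc_geom i ^+ 2 +
                                 b * b' * trunc_geom (t - i) ^+ 2)).
  apply: eq_big_nat => i /andP[i0 it]; rewrite !starE; try lia.
  (* The distances to the two ends add up to t > 2m, so the mixed terms vanish. *)
  have := @trunc_geom_disjoint i (t - i); rewrite subnKC; last lia.
  move=> /(_ (ltnW mt)) z.
  by rewrite -/a -/a' -/b -/b'; ring: z.
by rewrite big_split /= -!mulr_sumr sq sq' mulrDl.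
Qed.

Lemma adj_form_star (v v' : G) : adj_form (star v) (star v') =
  (v == v')%:R * ((degree v)%:R * (2 * \sum_(i < m) r ^+ i * r ^+ i.+1)).
Proof.
rewrite adj_form_subdivision; last lia.
rewrite mulrA -sum_ends_pair mulr_suml; apply: eq_bigr => p _.
set a := (_ == v)%:R; set a' := (_ == v')%:R.
set b := ((val p).2 == v)%:R; set b' := ((val p).2 == v')%:R.
have prod : \sum_(i < t) trunc_geom i * trunc_geom i.+1 = \sum_(i < m) r ^+ i * r ^+ i.+1.
  rewrite (@sum_ord_truncate _ (fun i => trunc_geom i * trunc_geom i.+1) m) => [||i im].
  - by apply: eq_bigr => i _; rewrite /trunc_geom ltnW ltn_ord.
  - by lia.
  - by rewrite {2}/trunc_geom ltnNge im mulr0.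
have prod' : \sum_(i < t) trunc_geom (t - i.+1) * trunc_geom (t - i.+1).+1 =
    \sum_(i < m) r ^+ i * r ^+ i.+1.
  rewrite -prod (reindex_inj rev_ord_inj) /=; apply: eq_bigr => i _.
  by have it := ltn_ord i; have -> : (t - (t - i.+1).+1)%N = i by lia.
transitivity (\sum_(i < t) (a * a' * (2 * (trunc_geom i * trunc_geom i.+1)) +
                b * b' * (2 * (trunc_geom (t - i.+1) * trunc_geom (t - i.+1).+1)))).
  apply: eq_bigr => i _; have it := ltn_ord i; rewrite !starE; try lia.
  have -> : (t - i)%N = (t - i.+1).+1 by lia.
  (* In the mixed terms of one step the two distances add up to t - 1 or t + 1; that t - 1 exceeds
     2m is exactly [mt]. *)
  have z1 := @trunc_geom_disjoint i (t - i.+1) ltac:(lia).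
  have z2 := @trunc_geom_disjoint i.+1 (t - i.+1).+1 ltac:(lia).
  by rewrite -/a -/a' -/b -/b'; ring: z1 z2.
rewrite big_split /= -!mulr_sumr.
by rewrite prod prod' [RHS]mulrDl.
Qed.

End Stars.

(** * Test functions on segments of one subdivided edge *)

Section Segments.
Variables (R : realType) (G : sgraph) (t m k : nat) (s : R) (p0 : edge G).
Hypothesis s1 : s ^+ 2 = 1.
Hypothesis kt : (k * m.+2 < t)%N.

(** A block of m + 1 positions; the excluded multiples of m + 2 separate consecutive blocks. *)
Definition in_segment (j i : nat) : bool := (j * m.+2 < i < j.+1 * m.+2)%N.

Definition segment (j : nat) (x : subdivision G t) : R :=
  match x with
  | inl _ => 0
  | inr (p, o) => (p == p0)%:R * ((in_segment j o.+1)%:R * s ^+ o.+1)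
  end.

Lemma segmentE j p i : (j < k)%N -> (i <= t)%N ->
  segment j (path_vertex t p i) = (p == p0)%:R * ((in_segment j i)%:R * s ^+ i).
Proof.
move=> jk; case: i => [_|i it]; first by rewrite /in_segment mul0r mulr0.
have [->|it'] := eqVneq i.+1 t.
  have jt : (j.+1 * m.+2 <= k * m.+2)%N by rewrite leq_mul2r jk orbT.
  rewrite path_vertex_last /=; last lia.
  rewrite (_ : in_segment j t = false) ?mul0r ?mulr0//.
  by apply/negP => /andP[_]; lia.
have it1 : (i < t.-1)%N by lia.
by rewrite (path_vertex_inner p (Ordinal it1)).
Qed.

(** Allowing positions up to one apart covers disjointness and non-adjacency of segments at once. *)
Lemma in_segment_disjoint j j' i i' : (i' <= i.+1)%N -> (i <= i'.+1)%N -> j != j' ->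
  in_segment j i && in_segment j' i' = false.
Proof.
move=> ii' i'i; rewrite neq_ltn => jj'; apply/negP.
rewrite /in_segment => /andP[/andP[a b] /andP[a' b']].
case/orP: jj' => jj.
  have : (j.+1 * m.+2 <= j' * m.+2)%N by rewrite leq_mul2r jj orbT.
  by lia.
have : (j'.+1 * m.+2 <= j * m.+2)%N by rewrite leq_mul2r jj orbT.
by lia.
Qed.

Lemma sum_in_segment (P : pred nat) a b n : (a <= b)%N -> (b <= n)%N ->
  (forall i, P i = (a <= i < b)%N) -> \sum_(i < n) (P i)%:R = (b - a)%:R :> R.
Proof.
move=> ab bn PE; rewrite -(big_mkord xpredT (fun i => (P i)%:R)).
rewrite (big_cat_nat (n := a))//=; last exact: leq_trans bn.
rewrite [X in X + _]big_nat [X in X + _]big1 ?add0r => [|i /andP[_ ia]]; last first.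
  by rewrite PE leqNgt ia.
rewrite (big_cat_nat (n := b))//= [X in _ + X]big_nat [X in _ + X]big1 =>
  [|i /andP[bi _]]; last first.
  by rewrite PE [(i < b)%N]ltnNge bi andbF.
rewrite addr0 (eq_big_nat _ _ (F2 := fun=> 1)) => [|i abi]; last by rewrite PE abi.
by rewrite sumr_const_nat.
Qed.

Lemma sum_segment j j' : (j < k)%N -> (j' < k)%N ->
  \sum_x segment j x * segment j' x = (j == j')%:R * m.+1%:R.
Proof.
move=> jk j'k.
rewrite sum_subdivision /= big1 ?add0r => [|v _]; last by rewrite mul0r.
rewrite (bigD1 p0)//= [X in _ + X]big1 ?addr0 => [|p /negPf pp0]; last first.
  apply: big1_seq => i; rewrite mem_index_iota => /andP[_ /andP[_ it]].
  by rewrite segmentE ?pp0 ?mul0r// ltnW.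
transitivity (\sum_(1 <= i < t) (in_segment j i && in_segment j' i)%:R : R).
  apply: eq_big_nat => i /andP[_ it]; rewrite !segmentE ?(ltnW it)// eqxx !mul1r.
  rewrite mulrACA -expr2 exprAC s1 expr1n mulr1 -natrM.
  by case: in_segment; case: in_segment.
have [<-|jj'] := eqVneq; last first.
  by rewrite mul0r big1 // => i _; rewrite in_segment_disjoint.
under eq_bigr do rewrite andbb.
have jt : (j.+1 * m.+2 <= k * m.+2)%N by rewrite leq_mul2r jk orbT.
rewrite big_add1 big_mkord.
rewrite (@sum_in_segment (fun i => in_segment j i.+1) (j * m.+2) (j.+1 * m.+2).-1).
- by rewrite mul1r; congr (_%:R); lia.
- by lia.
- by lia.
- by move=> i; rewrite /in_segment; lia.
Qed.

(** A segment contains m steps, each counted in both directions with value 1 because s^2 = 1.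
    Against the squared norm m + 1 this gives the Rayleigh quotient 2m/(m + 1). *)
Lemma adj_form_segment j j' : (j < k)%N -> (j' < k)%N ->
  s * adj_form (segment j) (segment j') = (j == j')%:R * (2 * m%:R).
Proof.
move=> jk j'k; rewrite adj_form_subdivision; last lia.
rewrite (@big_only1 _ _ _ _ p0)// => [|p /negPf pp0 _]; last first.
  apply: big1 => i _; have it := ltn_ord i.
  by rewrite !segmentE ?pp0 ?mul0r ?addr0//; lia.
rewrite mulr_sumr.
transitivity (\sum_(i < t) ((in_segment j i && in_segment j' i.+1)%:R +
                            (in_segment j i.+1 && in_segment j' i)%:R) : R).
  apply: eq_bigr => i _; have it := ltn_ord i; rewrite !segmentE ?(ltnW it)// eqxx !mul1r.
  have ss : s * (s ^+ i * s ^+ i.+1) = 1.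
    by rewrite mulrA -exprS -expr2 exprAC s1 expr1n.
  move: ss; set x := s ^+ i; set y := s ^+ i.+1 => ss.
  by rewrite -!mulnb !natrM; ring: ss.
have [<-|jj'] := eqVneq; last first.
  by rewrite mul0r big1 // => i _; rewrite !in_segment_disjoint ?addr0//; lia.
have jt : (j.+1 * m.+2 <= k * m.+2)%N by rewrite leq_mul2r jk orbT.
rewrite big_split /= (@sum_in_segment (fun i => in_segment j i && in_segment j i.+1)
  (j * m.+2).+1 (j.+1 * m.+2).-1); first last.
- by move=> i; rewrite /in_segment; lia.
- by lia.
- by lia.
rewrite (@sum_in_segment (fun i => in_segment j i.+1 && in_segment j i)
  (j * m.+2).+1 (j.+1 * m.+2).-1); first last.
- by move=> i; rewrite /in_segment; lia.
- by lia.
- by lia.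
rewrite mul1r mulr2n mulrDl !mul1r.
by congr (_%:R + _%:R); lia.
Qed.

End Segments.

(** * Counting vertices by degree *)

Section DegreeCounts.
Variable G : sgraph.

Lemma card_degree (P : pred nat) :
  #|[set v : G | P (degree v)]%SET| = count P (degree_seq G).
Proof.
rewrite /degree_seq;
have /permP -> := permEl (perm_sort geq [seq degree v | v <- enum G]).
rewrite count_map -sum1_card -sum1_count big_enum_cond.
by apply: eq_bigl => v; rewrite !inE.
Qed.

Lemma degree_seq_nth i j : (i <= j < size (degree_seq G))%N ->
  (nth 0 (degree_seq G) j <= nth 0 (degree_seq G) i)%N.
Proof.
move=> /andP[ij js].
have srt : sorted geq (degree_seq G).
  by apply: sort_sorted => x y; exact: leq_total.
have tr : transitive geq by move=> y x z /= yx zy; exact: leq_trans zy yx.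
have := sorted_leq_nth tr leqnn 0%N srt; apply => //.
by rewrite inE (leq_ltn_trans ij).
Qed.

(** Only the first k - 1 entries of the sorted degree sequence can exceed the k-th. *)
Lemma card_degree_gt k : (0 < k)%N -> (#|[set v : G | deg G k < degree v]%SET| < k)%N.
Proof.
move=> k0; rewrite (card_degree (fun d => deg G k < d)%N).
rewrite -[degree_seq G](cat_take_drop k.-1).
rewrite count_cat [X in (_ + X)%N](_ : _ = 0%N); last first.
  apply/eqP; rewrite -leqn0 leqNgt -has_count; apply/hasPn => d /(nthP 0%N)[i].
  rewrite size_drop => id <-; rewrite nth_drop -leqNgt.
  by apply: degree_seq_nth; rewrite leq_addr -ltn_subRL.
rewrite addn0 (leq_ltn_trans (count_size _ _))// size_take_min.
by rewrite (leq_ltn_trans (geq_minl _ _))// prednK.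
Qed.

Lemma card_degree_ge k : (0 < k)%N -> (0 < deg G k)%N ->
  (k <= #|[set v : G | deg G k <= degree v]%SET|)%N.
Proof.
move=> k0; have [ks|ks] := leqP k (size (degree_seq G)); last first.
  (* Past the end of the sequence [deg G k] is the default 0, contrary to its positivity. *)
  by rewrite /deg nth_default//; lia.
move=> _; rewrite (card_degree (fun d => deg G k <= d)%N).
rewrite -[degree_seq G](cat_take_drop k).
rewrite count_cat [X in (X + _)%N](_ : _ = k) ?leq_addr//.
rewrite -[RHS](size_takel ks); apply/eqP; rewrite -all_count.
apply/(all_nthP 0%N) => i; rewrite size_takel// => ik.
rewrite nth_take//; apply: degree_seq_nth.
by rewrite -ltnS prednK// ik.
Qed.

End DegreeCounts.

(** * Eigenvalue counts for all large t *)

(** [q^-1 - q] is the factor with which the geometric sum enters the Rayleigh estimate of a star. *)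
Lemma sum_sqr_geometric (F : fieldType) (q : F) m : q != 0 ->
  (\sum_(i < m) (q ^+ i.+1) ^+ 2) * (q^-1 - q) = q * (1 - (q ^+ 2) ^+ m).
Proof.
move=> q0; elim: m => [|m IH].
  by rewrite big_ord0 mul0r expr0 subrr mulr0.
have e : (q ^+ m.+1) ^+ 2 = q ^+ 2 * (q ^+ 2) ^+ m by rewrite exprAC exprS.
by rewrite big_ord_recr /= mulrDl IH e (exprS _ m); move: ((q ^+ 2) ^+ m) => x; field.
Qed.

Section Asymptotics.
Variables (R : realType) (G : sgraph) (s : R).
Hypothesis s1 : s ^+ 2 = 1.

(** The equation for [D] and [q] says (D - 1) q^2 = 1; q = 1 is the case D = 2. *)
Lemma near_count_le (D k : nat) (q e : R) : (0 < k)%N -> 0 < q <= 1 -> 0 < e ->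
  D%:R * q = q + q^-1 -> (#|[set v : G | D < degree v]%SET| < k)%N ->
  \forall t \near \oo, (#|subdivision G t| - k.-1 <=
    count (fun x => (s * x <= q + q^-1 + e)%R)
          (eigenvalues (adjmx R (subdivision G t))))%N.
Proof.
move=> k0 q01 e0 Dq Dk; near=> t.
pose S : {set subdivision G t} := [set inl v | v in [set v : G | D < degree v]%N]%SET.
have Sk : (#|S| <= k.-1)%N by rewrite card_imset ?prednK// => [|? ? []//]; lia.
apply: (leq_trans (leq_sub2l _ Sk)); apply: count_eigenvalues_vanishing => f f0.
apply: (@adj_form_subdivision_le _ _ _ f D) => //.
- by near: t; exact: nbhs_infty_gt.
- exact: ltW.
- rewrite -[leLHS]add0r lerD//; first by case/andP: q01 => /ltW.
  (* This makes t - 1 increments of size e add up to at least [q^-1]. *)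
  have : q^-1 / e + 1 <= t%:R by near: t; exact: nbhs_infty_ger.
  have t0 : (0 < t)%N by near: t; exact: nbhs_infty_gt.
  by rewrite -{1}(prednK t0) -natr1 lerD2r ler_pdivrMr.
- by move=> v Dv; apply: f0; apply/imsetP; exists v => //; rewrite inE.
Unshelve. all: by end_near.
Qed.

Lemma near_count_ge_star (D k : nat) (q e : R) : 0 < q < 1 -> 0 < e ->
  D%:R * q = q + q^-1 -> (k <= #|[set v : G | D <= degree v]%SET|)%N ->
  \forall t \near \oo, (k <=
    count (fun x => (q + q^-1 - e <= s * x)%R)
          (eigenvalues (adjmx R (subdivision G t))))%N.
Proof.
move=> /andP[q0 q1] e0 Dq Dk.
(* [m] is the radius of the stars; the left-hand side is the loss caused by truncating there. *)
have [m qm] : exists m, (q ^+ 2) ^+ m * (q + q^-1) <= e.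
  have L0 : 0 < q + q^-1 by rewrite addr_gt0 ?invr_gt0.
  have : (fun n => (q ^+ 2) ^+ n) @ \oo --> (0 : R).
    by apply: cvg_expr; rewrite ger0_norm ?sqr_ge0// expr_lt1// ltW.
  move=> /cvgrPdist_le/(_ (e / (q + q^-1)))[|m _ /(_ m (leqnn m))] /=.
    by rewrite divr_gt0.
  rewrite sub0r normrN ger0_norm; last by rewrite exprn_ge0 ?sqr_ge0.
  by rewrite ler_pdivlMr//; exists m.
near=> t.
have mt : (m.*2.+1 < t)%N by near: t; exact: nbhs_infty_gt.
pose N : R := \sum_(i < m) (q ^+ i.+1) ^+ 2.
have N0 : 0 <= N by apply: sumr_ge0 => i _; exact: sqr_ge0.
have NE : N * (q^-1 - q) = q * (1 - (q ^+ 2) ^+ m).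
  by apply: sum_sqr_geometric; rewrite gt_eqF.
pose r := s * q.
have rN : \sum_(i < m) (r ^+ i.+1) ^+ 2 = N.
  by apply: eq_bigr => i _; rewrite /r exprAC (exprMn 2 s q) s1 mul1r exprAC.
(* Each product is an odd power of s q, so the outer s makes every term positive. *)
have rC : s * (\sum_(i < m) r ^+ i * r ^+ i.+1) = N / q.
  rewrite /N mulr_suml mulr_sumr; apply: eq_bigr => i _.
  rewrite /r !exprMn !exprS.
  have sn : (s ^+ i) ^+ 2 = 1 by rewrite exprAC s1 expr1n.
  transitivity ((s ^+ 2) * (s ^+ i) ^+ 2 * (q ^+ i * (q * q ^+ i))); first by ring.
  by rewrite sn s1; field; rewrite gt_eqF.
apply: (leq_trans Dk).
pose I : finType := {v : G | (D <= degree v)%N}.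
have <- : #|I| = #|[set v : G | (D <= degree v)%N]%SET| by rewrite card_sig cardsE.
apply: (@count_eigenvalues_family R (subdivision G t) I
  (fun v : I => @star R G t m r (val v))).
- by move=> v w vw; rewrite sum_star// (inj_eq val_inj) (negPf vw) mul0r.
- by move=> v w vw; rewrite adj_form_star// (inj_eq val_inj) (negPf vw) mul0r.
- by move=> v; rewrite sum_star// rN eqxx mul1r ltr_pwDl// mulr_ge0.
case=> v Dv /=.
rewrite adj_form_star// sum_star// rN eqxx !mul1r.
have -> : s * ((degree v)%:R * (2 * \sum_(i < m) r ^+ i * r ^+ i.+1)) =
    (degree v)%:R * (2 * (N / q)) by rewrite -rC; ring.
(* By [NE] and [Dq] the value for degree D is (q + 1/q)(1 - q^(2m)), and a larger degree only
   increases it. *)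
have dN : (degree v)%:R * (N * (q^-1 - q)) >= (q + q^-1) - e.
  apply: (@le_trans _ _ (D%:R * (N * (q^-1 - q)))); last first.
    rewrite ler_wpM2r ?ler_nat// mulr_ge0// subr_ge0 ltW// (lt_trans q1)//.
    by rewrite invf_gt1.
  by rewrite NE mulrA Dq; move: qm; nra.
have : 0 <= (degree v)%:R * N * e by rewrite !mulr_ge0// ltW.
rewrite -subr_ge0 => dNe; rewrite -subr_ge0.
have -> : (degree v)%:R * (2 * (N / q)) - (q + q^-1 - e) * (1 + (degree v)%:R * N) =
    ((degree v)%:R * (N * (q^-1 - q)) - (q + q^-1 - e)) + (degree v)%:R * N * e.
  by ring.
by rewrite addr_ge0 ?subr_ge0//; rewrite subr0 in dNe.
Unshelve. all: by end_near.
Qed.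

Lemma near_count_ge_segment (k : nat) (e : R) : (exists u v : G, adj u v) -> 0 < e ->
  \forall t \near \oo, (k <=
    count (fun x => (2 - e <= s * x)%R)
          (eigenvalues (adjmx R (subdivision G t))))%N.
Proof.
move=> [u [v uv]] e0.
(* An [edge] is stored only in increasing enumeration order, so the given adjacent pair may have to
   be swapped. *)
have oriented (a b : G) : adj a b -> (enum_rank a < enum_rank b)%N ->
    exists p : edge G, val p = (a, b).
  move=> ab lt; have h : adj a b && (enum_rank a < enum_rank b)%N by rewrite ab.
  by exists (exist (fun p : G * G =>
    adj p.1 p.2 && (enum_rank p.1 < enum_rank p.2)%N) (a, b) h).
have [p0 _] : exists p : edge G, True.
  have [lt|lt|/ord_inj/enum_rank_inj uE] := ltngtP (enum_rank u) (enum_rank v).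
  - by have [p _] := oriented _ _ uv lt; exists p.
  - by have [|p _] := oriented _ _ _ lt; [rewrite adj_sym|exists p].
  - by rewrite uE adj_irrefl in uv.
(* Chosen so that 2m/(m + 1) = 2 - 2/(m + 1) is at least 2 - e. *)
pose m := Num.truncn (2 / e).
have me : 2 <= e * m.+1%:R.
  by rewrite mulrC -ler_pdivrMr// ltW// truncnS_gt.
near=> t.
have kt : (k * m.+2 < t)%N by near: t; exact: nbhs_infty_gt.
rewrite -[leqLHS]card_ord.
apply: (@count_eigenvalues_family _ _ _ (fun j : 'I_k => @segment R G t m s p0 j)).
- by move=> i j ij; rewrite (sum_segment (k := k))// (negPf (ij : i != j :> nat)) mul0r.
- move=> i j ij; have := adj_form_segment p0 s1 kt (ltn_ord i) (ltn_ord j).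
  rewrite (negPf (ij : i != j :> nat)) mul0r => /(congr1 ( *%R s)).
  by rewrite mulrA -expr2 s1 mul1r mulr0.
- by move=> j; rewrite (sum_segment (k := k))// eqxx mul1r.
move=> j; rewrite (sum_segment (k := k))// (adj_form_segment (k := k))// eqxx !mul1r.
by move: me; rewrite -natr1; nra.
Unshelve. all: by end_near.
Qed.

End Asymptotics.

(** * Limits at both ends of the spectrum *)

Theorem theorem1p3 (R : realType) (G : sgraph)
    (hE : exists u v : G, adj u v) (k : nat) (hk : (0 < k)%N) :
  let L : R :=
    if (k <= #|G|)%N && (3 <= deg G k)%N
    then (deg G k)%:R / Num.sqrt ((deg G k)%:R - 1)
    else 2 in
  ((fun t : nat => lambda R (subdivision G t) k) @ \oo --> L) /\
  ((fun t : nat =>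
      lambda R (subdivision G t) (#|subdivision G t| - k + 1)%N) @ \oo --> - L).
Proof.
move=> L; set E := fun t => eigenvalues (adjmx R (subdivision G t)).
(* The two counts trap the k-th largest value of s x within e of [L]: s = 1 gives the k-th largest
   eigenvalue, s = -1 the k-th smallest. *)
have counts (s e : R) : s ^+ 2 = 1 -> 0 < e -> \forall t \near \oo,
    (#|subdivision G t| - k.-1 <= count (fun x => (s * x <= L + e)%R) (E t))%N /\
    (k <= count (fun x => (L - e <= s * x)%R) (E t))%N.
  move=> s1 e0; rewrite /L; case: ifPn => [/andP[_ d3]|].
    set d := deg G k in d3 *; pose r : R := Num.sqrt (d%:R - 1).
    have r2 : r ^+ 2 = d%:R - 1 by rewrite sqr_sqrtr// subr_ge0 ler1n; lia.
    have r1 : 1 < r.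
      have d3' : 3 <= d%:R :> R by rewrite ler_nat.
      rewrite -[ltLHS]sqrtr1 ltr_sqrt; lra.
    have r0 : 0 < r by lra.
    have -> : d%:R / r = r^-1 + r^-1^-1.
      rewrite invrK (_ : d%:R = r ^+ 2 + 1); last by rewrite r2 subrK.
      by field; rewrite gt_eqF.
    have Dq : d%:R * r^-1 = r^-1 + r^-1^-1.
      rewrite invrK (_ : d%:R = r ^+ 2 + 1); last by rewrite r2 subrK.
      by field; rewrite gt_eqF.
    have q0 : 0 < r^-1 by rewrite invr_gt0.
    have q1 : r^-1 < 1 by rewrite invf_lt1.
    near=> t; split; near: t.
      apply: near_count_le Dq _ => //; first by rewrite q0 ltW.
      exact: card_degree_gt.
    apply: near_count_ge_star Dq _ => //; first by rewrite q0.
    by apply: card_degree_ge => //; lia.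
  (* This includes k > n, where [deg G k] is the default 0. The bounds are then used with D = 2 and
     q = 1. *)
  move=> nd; have d2 : (deg G k <= 2)%N.
    move: nd; rewrite negb_and -ltnNge -ltnNge => /orP[kn|//].
    by rewrite /deg nth_default// /degree_seq size_sort size_map -cardE -ltnS prednK.
  near=> t; split; near: t; last exact: near_count_ge_segment.
  rewrite (_ : 2 = 1 + 1^-1 :> R); last by rewrite invr1.
  apply: (@near_count_le _ _ _ _ 2) => //; rewrite ?invr1 ?mulr1//.
    by rewrite ltr01 lexx.
  apply: leq_ltn_trans (card_degree_gt G hk); apply: subset_leq_card.
  by apply/fintype.subsetP => v; rewrite !inE; apply: leq_ltn_trans.
have srt t : sorted >=%R (E t) by apply: sort_sorted => x y; exact: le_total.
split; apply/cvgrPdist_le => e e0; near=> t.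
  have [] : (#|subdivision G t| - k.-1 <= count (fun x => (1 * x <= L + e)%R) (E t))%N /\
    (k <= count (fun x => (L - e <= 1 * x)%R) (E t))%N.
    by near: t; apply: counts => //; rewrite expr1n.
  rewrite (eq_count (a2 := <= (L + e))) => [U|x]; last by rewrite mul1r.
  rewrite (eq_count (a2 := >= (L - e))) => [W|x]; last by rewrite mul1r.
  (* The lower count itself puts k within range, so [nth] does not return its default. *)
  have kN : (k <= size (E t))%N by apply: leq_trans W (count_size _ _).
  have lo : L - e <= nth 0 (E t) k.-1 by apply: nth_sorted_ge; rewrite ?prednK.
  have hi : nth 0 (E t) k.-1 <= L + e.
    by apply: nth_sorted_le; rewrite ?prednK// size_eigenvalues.
  by rewrite ler_norml /lambda; apply/andP; split; lra.
have [] : (#|subdivision G t| - k.-1 <= count (fun x => (-1 * x <= L + e)%R) (E t))%N /\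
    (k <= count (fun x => (L - e <= -1 * x)%R) (E t))%N.
  by near: t; apply: counts => //; rewrite sqrrN expr1n.
rewrite (eq_count (a2 := >= - (L + e))) => [U|x]; last by rewrite mulN1r lerNl.
rewrite (eq_count (a2 := <= - (L - e))) => [W|x]; last by rewrite mulN1r lerNr.
have kN : (k <= size (E t))%N by apply: leq_trans W (count_size _ _).
have sE : size (E t) = #|subdivision G t| by exact: size_eigenvalues.
(* Number N - k + 1 counted from 1, with N the number of vertices, is index N - k counted from 0;
   [U] provides the required N - k + 1 eigenvalues because k <= N. *)
have lo : - (L + e) <= nth 0 (E t) (#|subdivision G t| - k)%N.
  apply: nth_sorted_ge => //; apply: leq_trans U.
  by rewrite -subSn -?sE// -{1}(prednK hk) subSS.
have hi : nth 0 (E t) (#|subdivision G t| - k)%N <= - (L - e).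
  apply: nth_sorted_le => //; last by rewrite sE subKn// -sE.
  by rewrite sE ltn_subrL hk -sE (leq_trans hk).
by rewrite ler_norml /lambda addn1 /=; apply/andP; split; lra.
Unshelve. all: by end_near.
Qed.
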